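(* Let $q$ be an odd prime power with $q>5$, and let $a,b\in\mathbb{F}_q$ with $a\neq 0$. Then \[ S(X^4+aX^2+b) = -\Bigl(\frac{4+\chi(-1)+4\chi(-2a)}{64}\Bigr)\cdot a^2 + \Bigl(\frac{4+\chi(-1)-2\chi(-a)+2\chi(-2a)}{8}\Bigr)\cdot b . \]
   Context: For $f(X)\in\mathbb{F}_q[X]$, $f(\mathbb{F}_q):=\{f(x):x\in\mathbb{F}_q\}$ is the value set (a set, without multiplicity) and $S(f)$ denotes the sum of the elements of $f(\mathbb{F}_q)$. For odd $q$, $\chi$ is the quadratic character on $\mathbb{F}_q$: $\chi(x):=x^{(q-1)/2}$, so $\chi(x)=1$ for nonzero squares, $-1$ for nonsquares, $\chi(0)=0$. Rational numbers are interpreted in $\mathbb{F}_q$. *)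

(* Defs.v *)
From HB Require Import structures.
From mathcomp Require Import all_boot all_order all_algebra.

Set Implicit Arguments.
Unset Strict Implicit.
Unset Printing Implicit Defensive.

Import GRing.Theory.
Local Open Scope ring_scope.

(* [value_set] is a {set F}, so repeated values are counted only once in
   [value_sum]. *)
Definition value_set (F : finFieldType) (f : {poly F}) : {set F} :=
  [set f.[x] | x : F].

Definition value_sum (F : finFieldType) (f : {poly F}) : F :=
  \sum_(y in value_set f) y.

(* The quadratic character for odd #|F|, with values 0, 1, -1 taken in F. *)
Definition quad_char (F : finFieldType) (x : F) : F :=
  x ^+ ((#|F| - 1) %/ 2)%N.

(* Main.v *)
Require Import Defs.
From HB Require Import structures.
From mathcomp Require Import all_boot all_order all_algebra.
From mathcomp Require Import cyclic finfield zify ring.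

Set Implicit Arguments.
Unset Strict Implicit.
Unset Printing Implicit Defensive.

Import GRing.Theory.
Local Open Scope ring_scope.

(** Write g(t) = t^2 + a t + b, so that the polynomial takes the values g(t) for
    t a square (0 included).  A value g(t) is attained iff t or -a-t is a square,
    and g is 2-to-1 except at t = -a/2, so twice the sum over the value set is
    sum_t g(t) (s(t) + s(-a-t) - s(t) s(-a-t)) plus g(-a/2) s(-a/2), where
    s = (1 + chi + [t = 0]) / 2 is the indicator of squares.  As chi is the
    power t^((q-1)/2), everything reduces to power sums over F; the only ones
    that do not vanish are the sums of (t^2 + a t)^k for k = (q-1)/2 and
    k = (q+1)/2, and there the binomial coefficient 'C((q+1)/2, 2) = -1/8 in F
    appears. *)

Section FiniteField.
Variable F : finFieldType.
Implicit Types (x y t a : F) (k : nat).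

Lemma finField_card_gt1 : (1 < #|F|)%N.
Proof. exact: finNzRing_gt1. Qed.

Lemma finField_expf_card1 x : x != 0 -> x ^+ #|F|.-1 = 1.
Proof.
move=> x0; apply: (mulfI x0); rewrite mulr1 -exprS prednK ?expf_card //.
exact: ltnW finField_card_gt1.
Qed.

(** Translation by 1 permutes [F], so adding 1 to each of the [#|F|] terms leaves the sum of all
    elements unchanged. *)
Lemma finField_card_eq0 : #|F|%:R = 0 :> F.
Proof.
have /eqP : \sum_(x : F) x = \sum_x (x + 1) by exact: reindex_inj (addIr 1).
by rewrite big_split sumr_const /= -subr_eq0 opprD addNKr oppr_eq0 => /eqP.
Qed.

Lemma finField_prim_root : exists z : F, #|F|.-1.-primitive_root z.
Proof.
have n0 : (0 < #|F|.-1)%N by have := finField_card_gt1; lia.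
have: has #|F|.-1.-primitive_root (enum [pred x : F | x != 0]).
  apply: has_prim_root n0 _ (enum_uniq _) _.
    apply/allP=> x; rewrite mem_enum inE => x0.
    by rewrite unity_rootE finField_expf_card1.
  by rewrite -cardE -(cardC1 (0 : F)) leqnn.
by case/hasP=> z _ zP; exists z.
Qed.

(** Multiplication by a primitive root [z] permutes [F], so the sum is fixed by the factor [z ^+ k].
    Either it vanishes, or [z ^+ k = 1] and each nonzero [x] contributes 1. The case [k = 0] is
    separate because [0 ^+ 0 = 1]. *)
Lemma sum_expf k :
  \sum_(x : F) x ^+ k = - ((0 < k)%N && (#|F|.-1 %| k)%N)%:R.
Proof.
case: k => [|k] /=.
  rewrite (eq_bigr (fun=> 1)) => [|x _]; last by rewrite expr0.
  by rewrite sumr_const finField_card_eq0 oppr0.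
have [z zP] := finField_prim_root.
have n0 := prim_order_gt0 zP.
have z0 : z != 0.
  apply: contra_eq_neq (prim_expr_order zP) => ->.
  by rewrite expr0n eqn0Ngt n0 eq_sym oner_eq0.
rewrite (prim_order_dvd zP); case: eqP => [zk1|/eqP zk1].
  rewrite (bigD1 0) //= expr0n add0r (eq_bigr (fun=> 1)); last first.
    move=> x /finField_expf_card1 x1; have [i ->] := prim_rootP zP x1.
    by rewrite exprAC zk1 expr1n.
  rewrite sumr_const cardC1; apply/eqP.
  by rewrite -addr_eq0 natr1 prednK ?finField_card_eq0 // ltnW // finField_card_gt1.
have /eqP : \sum_(x : F) x ^+ k.+1 = z ^+ k.+1 * \sum_(x : F) x ^+ k.+1.
  rewrite {1}(reindex_inj (mulfI z0)) mulr_sumr.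
  by apply: eq_bigr => x _; rewrite exprMn.
rewrite -subr_eq0 -{1}[X in X - _]mul1r -mulrBl mulf_eq0 subr_eq0.
by rewrite eq_sym (negPf zk1) oppr0 => /eqP.
Qed.

Lemma sum_expf0 k : (k < #|F|.-1)%N -> \sum_(x : F) x ^+ k = 0.
Proof.
move=> kq; rewrite sum_expf; case: andP => [[k0 /(dvdn_leq k0)]|_].
  by rewrite leqNgt kq.
by rewrite oppr0.
Qed.

Lemma sum_quadratic_expf a b k : (k.+2 < #|F|.-1)%N ->
  \sum_t (t ^+ 2 + a * t + b) * t ^+ k = 0.
Proof.
move=> kq.
rewrite (eq_bigr (fun t => t ^+ k.+2 + a * t ^+ k.+1 + b * t ^+ k)); last first.
  by move=> t _; rewrite !exprS; ring.
by rewrite !big_split -!mulr_sumr /= !sum_expf0 ?mulr0 ?addr0 //; lia.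
Qed.

(* Only the monomial of degree [#|F|.-1] of the expanded product survives. *)
Lemma sum_quadratic_pow a k : (#|F|.-1 <= k.*2)%N -> (k < #|F|.-1)%N ->
  \sum_t (t ^+ 2 + a * t) ^+ k
    = - (a ^+ (k.*2 - #|F|.-1) *+ 'C(k, k.*2 - #|F|.-1)).
Proof.
move=> qk kq; set d := (k.*2 - _)%N.
have dk : (d < k.+1)%N by rewrite /d; lia.
rewrite (eq_bigr (fun t : F =>
    \sum_(i < k.+1) (a ^+ i *+ 'C(k, i)) * t ^+ (k.*2 - i))); last first.
  move=> t _; rewrite exprDn; apply: eq_bigr => i _.
  rewrite [(a * t) ^+ _]exprMn -exprM mulrnAl; congr (_ *+ _).
  rewrite mulrCA -exprD; congr (_ * t ^+ _).
  by have := ltn_ord i; lia.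
rewrite exchange_big /= (bigD1 (Ordinal dk)) //= [X in _ + X]big1 => [|i ni].
  rewrite addr0 -mulr_sumr sum_expf (_ : (k.*2 - d = #|F|.-1)%N); last by rewrite /d; lia.
  rewrite dvdnn andbT (_ : (0 < _)%N) ?mulrN ?mulr1 //; lia.
(* As [k < #|F|.-1], the exponent is below twice [#|F|.-1]; its only possible positive multiple is
   [#|F|.-1] itself, which forces [i = d]. *)
rewrite -mulr_sumr sum_expf; case: andP => [[_ /dvdnP[j jE]]|_].
  case/negP: ni; rewrite -val_eqE /= /d.
  have := ltn_ord i; move: jE; case: j => [|[|j]]; rewrite ?mulSn; nia.
by rewrite mulr0n oppr0 mulr0.
Qed.

Definition is_square x := [exists y : F, y ^+ 2 == x].

Lemma quad_charM x y : quad_char (x * y) = quad_char x * quad_char y.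
Proof. exact: exprMn. Qed.

Hypothesis qodd : odd #|F|.

Lemma odd_card_pred : #|F|.-1 = ((#|F| - 1) %/ 2 * 2)%N.
Proof. by have := qodd; have := finField_card_gt1; lia. Qed.

Lemma finField_two_neq0 : (2 : F) != 0.
Proof.
apply/eqP => c2; have /eqP := finField_card_eq0.
rewrite -(odd_double_half #|F|) qodd -muln2 natrD natrM c2 mulr0 addr0.
by rewrite oner_eq0.
Qed.

Lemma quad_char_sqr x : x != 0 -> quad_char (x ^+ 2) = 1.
Proof.
move=> x0; rewrite /quad_char -exprM mulnC -odd_card_pred.
exact: finField_expf_card1.
Qed.

Lemma quad_char0 : quad_char (0 : F) = 0.
Proof.
rewrite /quad_char expr0n; have := odd_card_pred; have := finField_card_gt1.
by case: eqP => // ->; lia.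
Qed.

(** The value squares to 1. Were it 1, then writing [x = z ^+ i] with [z] a primitive root,
    [#|F|.-1] would divide [i] times its own half, so [i] would be even and [x] a square. *)
Lemma quad_char_nonsquare x : ~~ is_square x -> quad_char x = -1.
Proof.
move=> nsq; have x0 : x != 0.
  by apply: contraNneq nsq => ->; apply/existsP; exists 0; rewrite expr0n.
have: quad_char x ^+ 2 == 1.
  by rewrite /quad_char -exprM -odd_card_pred finField_expf_card1.
rewrite sqrf_eq1 => /orP[/eqP x1|/eqP//]; case/negP: nsq.
have [z zP] := finField_prim_root.
have [[i /= _] xE] := prim_rootP zP (finField_expf_card1 x0).
move: x1; rewrite /quad_char xE -exprM => /eqP.
have n0 := prim_order_gt0 zP.
rewrite -(prim_order_dvd zP) odd_card_pred [(i * _)%N]mulnC dvdn_pmul2l; last first.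
  by have := odd_card_pred; lia.
case/dvdnP=> j ->.
by apply/existsP; exists (z ^+ j); rewrite exprM.
Qed.

Lemma is_squareE x :
  (is_square x)%:R = (1 + quad_char x + (x == 0)%:R) / 2 :> F.
Proof.
have n2 := finField_two_neq0.
have [->|x0] := eqVneq x 0.
  rewrite quad_char0 (_ : is_square 0) /=; first by field.
  by apply/existsP; exists 0; rewrite expr0n.
have [/existsP[y /eqP yx]|/quad_char_nonsquare->] := boolP (is_square x).
  rewrite -yx quad_char_sqr /=; first by field.
  by apply: contraNneq x0 => y0; rewrite -yx y0 expr0n.
by rewrite subrr !add0r mul0r.
Qed.


(* The fibres of [t |-> t ^+ 2 + a * t + b] are the orbits of the involution
   [t |-> - a - t], whose only fixed point is [- a / 2]. *)
Lemma quadratic_fibre a b x t :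
  (x ^+ 2 + a * x + b == t ^+ 2 + a * t + b) = (x == t) || (x == - a - t).
Proof.
rewrite -[x == t]subr_eq0 -[x == - a - t]subr_eq0 -mulf_eq0 -[LHS]subr_eq0.
by congr (_ == _); ring.
Qed.

Lemma double_sum_quadratic_image a b (V : {set F}) :
  {subset V <= [set t ^+ 2 + a * t + b | t : F]} ->
  let g t := t ^+ 2 + a * t + b in
  2 * (\sum_(y in V) y)
    = \sum_t (g t \in V)%:R * g t + (g (- a / 2) \in V)%:R * g (- a / 2).
Proof.
move=> subV g; have n2 := finField_two_neq0.
(* The correction is spread over [V] so that both sides can be compared value by value: fibre size
   plus correction is always 2. *)
have -> : (g (- a / 2) \in V)%:R * g (- a / 2) =
    \sum_(y in V) (y == g (- a / 2))%:R * y.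
  have [gV|gV] := boolP (g (- a / 2) \in V); last first.
    rewrite mul0r big1 // => y yV; case: eqP => [yg|_]; last by rewrite mul0r.
    by rewrite -yg yV in gV.
  rewrite (bigD1 _ gV) /= eqxx big1 ?addr0 // => y /andP[_ /negPf->].
  by rewrite mul0r.
have -> : \sum_t (g t \in V)%:R * g t = \sum_(t | g t \in V) g t.
  by rewrite [RHS]big_mkcond; apply: eq_bigr => t _; case: ifP; rewrite ?mul1r ?mul0r.
rewrite [X in _ = X + _](partition_big g (mem V)) //= -big_split mulr_sumr /=.
apply: eq_bigr => y yV; have /imsetP[t _ yE] := subV _ yV.
rewrite (eq_bigr (fun=> y)); last by move=> x /andP[_ /eqP].
rewrite (eq_bigl (mem [set t; - a - t])); last first.
  move=> x; rewrite !inE -(quadratic_fibre a b) -yE /g andbC.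
  by case: eqP => // ->.
rewrite sumr_const cards2 yE quadratic_fibre.
have -> : (t == - a - - a / 2) = (t == - a / 2).
  by congr (_ == _); field.
have -> : (t == - a - t) = (t == - a / 2).
  rewrite -[LHS](inj_eq (addIr t)) subrK -[RHS](inj_eq (mulIf n2)) divfK //.
  by rewrite mulr_natr mulr2n.
by rewrite orbb; case: eqP => _ /=; ring.
Qed.

Lemma horner_biquadratic a b x :
  ('X^4 + a *: 'X^2 + b%:P).[x] = (x ^+ 2) ^+ 2 + a * x ^+ 2 + b.
Proof. by rewrite !hornerE -exprM. Qed.

Lemma biquadratic_value_setE a b t :
  (t ^+ 2 + a * t + b \in value_set ('X^4 + a *: 'X^2 + b%:P))
    = is_square t || is_square (- a - t).
Proof.
apply/imsetP/orP => [[x _ /eqP]|].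
  rewrite horner_biquadratic eq_sym quadratic_fibre => sqx.
  by case/orP: sqx => /eqP xE; [left|right]; apply/existsP; exists x; rewrite xE.
by case=> /existsP[x /eqP xE]; exists x => //; apply/eqP;
  rewrite horner_biquadratic eq_sym quadratic_fibre xE eqxx ?orbT.
Qed.

End FiniteField.

Theorem theorem1p3 (F : finFieldType) (qodd : odd #|F|) (qgt5 : (5 < #|F|)%N)
    (a b : F) (a0 : a != 0) :
  value_sum ('X^4 + a *: 'X^2 + b%:P) =
    - ((4 + quad_char (-1) + 4 * quad_char (- 2 * a)) / 64) * a ^+ 2
    + ((4 + quad_char (-1) - 2 * quad_char (- a) + 2 * quad_char (- 2 * a)) / 8)
      * b.
Proof.
have n2 := finField_two_neq0 qodd.
have n2X k : (2 ^ k)%N%:R != 0 :> F by rewrite natrX expf_neq0.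
have n4 : (4 : F) != 0 := n2X 2.
have n8 : (8 : F) != 0 := n2X 3.
have n64 : (64 : F) != 0 := n2X 6.
pose g t := t ^+ 2 + a * t + b.
pose s (t : F) : F := (is_square t)%:R.
pose m := ((#|F| - 1) %/ 2)%N.
have q1E : #|F|.-1 = (m * 2)%N := odd_card_pred qodd.
have m2 : (2 < m)%N by rewrite /m; lia.
(* In [F], [2 * m = #|F| - 1 = -1]. *)
have mE : m%:R = - (1 / 2) :> F.
  apply: (mulIf n2); rewrite -natrM -q1E -subn1 natrB ?finField_card_eq0; last by lia.
  by field.
have g_refl t : g (- a - t) = g t by rewrite /g; ring.
have reflK t : - a - (- a - t) = t by ring.
have reflI : injective (fun t => - a - t) by move=> x y /addrI/oppr_inj.
have sum_g : \sum_t g t = 0.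
  rewrite -[RHS](@sum_quadratic_expf F a b 0); last by lia.
  by apply: eq_bigr => t _; rewrite expr0 mulr1.
(* The degree [m + 2] must stay below [#|F|.-1 = 2 * m], which is where [5 < #|F|] is needed. *)
have sum_gchi : \sum_t g t * quad_char t = 0.
  by apply: sum_quadratic_expf; rewrite q1E -/m; lia.
have sum_delta (d : F) (h : F -> F) : \sum_t h t * (t == d)%:R = h d.
  rewrite (bigD1 d) //= eqxx mulr1 big1 ?addr0 // => t /negPf->.
  by rewrite mulr0.
have sum_gs : \sum_t g t * s t = b / 2.
  rewrite (eq_bigr (fun t => (g t + g t * quad_char t + g t * (t == 0)%:R) / 2)).
    rewrite -mulr_suml 2!big_split /= sum_g sum_gchi sum_delta /g.
    by rewrite expr0n mulr0 !add0r.
  by move=> t _; rewrite /s is_squareE //; field.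
have sum_gs' : \sum_t g t * s (- a - t) = b / 2.
  rewrite -sum_gs (reindex_inj reflI); apply: eq_bigr => t _.
  by rewrite g_refl reflK.
have sum_gchichi : \sum_t g t * (quad_char t * quad_char (- a - t))
    = quad_char (-1) * (a ^+ 2 / 8 - b).
  (* Here [t * (- a - t) = - (t ^+ 2 + a * t)], and [g t] is [t ^+ 2 + a * t] plus [b]. *)
  rewrite (eq_bigr (fun t => quad_char (-1) *
    ((t ^+ 2 + a * t) ^+ m.+1 + b * (t ^+ 2 + a * t) ^+ m))); last first.
    move=> t _; rewrite -quad_charM (_ : t * (- a - t) = -1 * (t ^+ 2 + a * t)); last by ring.
    by rewrite quad_charM [quad_char (_ + _)]/quad_char -/m [_ ^+ m.+1]exprS /g; ring.
  rewrite -mulr_sumr big_split /= -mulr_sumr.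
  rewrite !sum_quadratic_pow ?q1E; try lia.
  rewrite (_ : m.+1.*2 - _ = 2)%N; last by lia.
  rewrite (_ : m.*2 - _ = 0)%N ?bin0; last by lia.
  (* With [m = -1/2] in [F], [(m + 1) * m / 2] is [(1/2) * (-1/2) / 2]. *)
  have bin2E : 'C(m.+1, 2)%:R = - (1 / 8) :> F.
    apply: (mulIf n2); rewrite -natrM (_ : 'C(_, _) * 2 = m.+1 * m)%N.
      by rewrite natrM -natr1 mE; field; rewrite n8 n2.
    by rewrite bin2 muln2 -[RHS]odd_double_half /= oddM /= andNb.
  by rewrite -mulr_natr bin2E; field.
have sum_gss : \sum_t g t * (s t * s (- a - t)) =
    (2 * b + 2 * b * quad_char (- a) + quad_char (-1) * (a ^+ 2 / 8 - b)) / 4.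
  have sum_gchi' : \sum_t g t * quad_char (- a - t) = 0.
    rewrite -[RHS]sum_gchi (reindex_inj reflI); apply: eq_bigr => t _.
    by rewrite g_refl reflK.
  (* The product of the two indicators is grouped by the point where it is supported. The cross term
     of [t = 0] and [t = - a] dies because [a != 0]; each of these points leaves
     [b * (1 + quad_char (- a))]. *)
  rewrite (eq_bigr (fun t => (g t + g t * quad_char t + g t * quad_char (- a - t)
      + g t * (quad_char t * quad_char (- a - t))
      + g t * (1 + quad_char (- a - t) + (t == - a)%:R) * (t == 0)%:R
      + g t * (1 + quad_char t) * (t == - a)%:R) / 4)); last first.
    move=> t _; rewrite /s !is_squareE // subr_eq0 [- a == t]eq_sym.
    by field; rewrite n2 n4.
  rewrite -mulr_suml 5!big_split /= sum_g sum_gchi sum_gchi' sum_gchichi.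
  rewrite !sum_delta subr0 eq_sym oppr_eq0 (negPf a0) /g /=.
  by congr (_ / _); ring.
(* The two arguments differ by the nonzero square [2 ^+ 2]. *)
have chi_c : quad_char (- a / 2) = quad_char (- 2 * a).
  rewrite (_ : - 2 * a = - a / 2 * 2 ^+ 2); last by field.
  by rewrite [RHS]quad_charM quad_char_sqr // mulr1.
have c0 : - a / 2 != 0 by rewrite mulf_neq0 ?oppr_eq0 ?invr_eq0.
have subV : {subset value_set ('X^4 + a *: 'X^2 + b%:P) <= [set g t | t : F]}.
  move=> _ /imsetP[x _ ->]; apply/imsetP; exists (x ^+ 2) => //.
  exact: horner_biquadratic.
apply: (mulfI n2); rewrite /value_sum (double_sum_quadratic_image qodd subV).
rewrite (eq_bigr (fun t => g t * s t + g t * s (- a - t)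
    - g t * (s t * s (- a - t)))); last first.
  move=> t _; rewrite biquadratic_value_setE /s /g.
  by case: is_square; case: is_square => /=; ring.
rewrite big_split sumrN big_split /= sum_gs sum_gs' sum_gss.
rewrite biquadratic_value_setE (_ : - a - - a / 2 = - a / 2) ?orbb; last by field.
rewrite is_squareE // (negPf c0) chi_c mulr0n.
by field; rewrite n2 n4 n8 n64.
Qed.
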